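(* Let $p$ be an odd prime and $n\ge1$. The Schur index with respect to $\mathbb{Q}$ of any irreducible complex representation of $\mathrm{Hol}(C_{p^n})$ is equal to $1$.
   Context: $C_m$ is the cyclic group of order $m$; $\mathrm{Hol}(C_m)=C_m\rtimes\mathrm{Aut}(C_m)$ for the natural action. For an irreducible complex representation $\widetilde\rho$ of a finite group $G$, there is a unique irreducible $\mathbb{Q}$-representation $\rho$ of $G$ such that $\widetilde\rho$ is a constituent of $\rho\otimes_{\mathbb{Q}}\mathbb{C}$; the Schur index of $\widetilde\rho$ with respect to $\mathbb{Q}$ is the multiplicity of $\widetilde\rho$ in $\rho\otimes_{\mathbb{Q}}\mathbb{C}$. *)

(* Defs.v *)
From HB Require Import structures.
From mathcomp Require Import all_boot all_order all_fingroup all_solvable.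
From mathcomp Require Import all_algebra all_character.
From mathcomp Require Import boolp classical_sets reals.
From mathcomp Require Import complex.

Set Implicit Arguments.
Unset Strict Implicit.
Unset Printing Implicit Defensive.

Import GroupScope GRing.Theory Num.Theory.

Definition Hol (gT : finGroupType) (G : {group gT}) :
  {group sdprod_by (aut_groupAction G)} := [set: _]%G.

(* For m > 0, [Zp m] is the group of integers modulo m; 'Z_m itself has order
   max(m, 2). *)
Definition HolC (m : nat) := Hol (Zp m)%G.

Section SchurIndex.

Variables (C : numClosedFieldType) (gT : finGroupType) (G : {group gT}).

(* The isotypic components W of sigma are pairwise non-isomorphic, so for rho
   irreducible at most one term of the sum is present; the sum is 0 when rho is
   not a constituent of sigma. *)
Definition multiplicity (d : nat) (rho : mx_representation C G d)
    (m : nat) (sigma : mx_representation C G m) : nat :=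
  \sum_(W : DecSocleType sigma | `[< mx_rsim (socle_repr W) rho >])
     socle_mult W.

Definition constituent (d : nat) (rho : mx_representation C G d)
    (m : nat) (sigma : mx_representation C G m) : Prop :=
  0 < multiplicity rho sigma.

Definition complexification (m : nat) (sigma : mx_representation rat G m) :
  mx_representation C G m := map_repr (ratr : {rmorphism rat -> C}) sigma.

(* The irreducible rational sigma below exists and is unique up to isomorphism
   when rho is irreducible; the default 0 is never a multiplicity of a
   constituent, so it cannot be confused with a genuine Schur index. *)
Definition schur_index (d : nat) (rho : mx_representation C G d) : nat :=
  xget 0 [set k | exists (m : nat) (sigma : mx_representation rat G m),
    [/\ mx_irreducible sigma,
        constituent rho (complexification sigma)
      & k = multiplicity rho (complexification sigma)] ]%classic.

End SchurIndex.

(* Main.v *)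
Require Import Defs.
From mathcomp Require Import all_boot all_order all_fingroup all_solvable.
From mathcomp Require Import all_algebra all_character.
From mathcomp Require Import boolp classical_sets reals.
From mathcomp Require Import complex.
From mathcomp Require Import ring.

(* If some subgroup H fixes exactly one line in the irreducible complex
   representation rho, the Schur index of rho is 1: in a rational irreducible
   sigma containing rho, H fixes a nonzero rational vector w, which generates
   sigma, so a homomorphism sigma -> rho is determined by the image of w, which
   lies on the fixed line; hence rho occurs once in sigma.

   In the holomorph <x> ><| A of C_(p^n) write v for a common eigenvector of x
   and of the stabilizer of its eigenvalue zeta, which has order p^m; for m > 0
   this stabilizer in A is generated by the automorphism g of exponent 1 + p^m,
   and v g = eps v with eps of order p^k.  The subgroup H is
   - trivial when m = 0, as rho is then linear;
   - <x g^i> with eps^i = zeta^-1 when m <= k;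
   - A when k = 0 < m;
   - <x^i b> when 0 < k < m, where b has exponent q = 1 + p^k and t = p^(m - k):
     the sum N of the q^s for s < t is p^(m - k) times a unit because p is odd,
     so that zeta^(i N) can be made to cancel the eigenvalue of b^t on v.
   That H fixes exactly one line is Mackey's formula. *)

Section Holomorph.

Set Implicit Arguments.
Unset Strict Implicit.
Unset Printing Implicit Defensive.

(** * Powers of 1 + p^k u modulo powers of an odd prime p *)

Lemma binomial_expansion3 (y s : nat) :
  exists w, (1 + y) ^ s = 1 + s * y + 'C(s, 2) * y ^ 2 + w * y ^ 3.
Proof.
elim: s => [|s [w IHs]]; first by exists 0; rewrite expn0.
exists ('C(s, 2) + w * (1 + y)); rewrite expnSr IHs binS bin1.
ring.
Qed.

Section PrincipalUnits.

Variables (p : nat) (p_prime : prime p) (p_odd : odd p).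

(** The linear term of the expansion is p^(k+1) u. The cubic term is divisible by p^(k+2) since k >
    0, and so is the quadratic one, because an odd p divides ['C(p, 2)]. *)
Lemma expn_1mod_step (k u : nat) : 0 < k -> ~~ (p %| u) ->
  exists2 u', (1 + p ^ k * u) ^ p = 1 + p ^ k.+1 * u' & ~~ (p %| u').
Proof.
move=> k_gt0 pNu; have [w ->] := binomial_expansion3 (p ^ k * u) p.
have [k' ->] : exists k', k = k'.+1 by exists k.-1; rewrite prednK.
have [q ->] : exists q, 'C(p, 2) = p * q.
  have /dvdnP[q ->] : p %| 'C(p, 2); last by exists q; rewrite mulnC.
  by rewrite prime_dvd_bin //= odd_prime_gt2.
exists (u + p * (q * p ^ k' * u ^ 2 + w * p ^ k' * p ^ k' * u ^ 3)).
  rewrite !expnS; ring.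
by rewrite dvdn_addl ?dvdn_mulr.
Qed.

Lemma expn_1mod_coprime (k u s : nat) : 0 < k -> ~~ (p %| u) -> ~~ (p %| s) ->
  exists2 u', (1 + p ^ k * u) ^ s = 1 + p ^ k * u' & ~~ (p %| u').
Proof.
move=> k_gt0 pNu pNs; have [w ->] := binomial_expansion3 (p ^ k * u) s.
have [k' ->] : exists k', k = k'.+1 by exists k.-1; rewrite prednK.
exists (s * u +
  p * ('C(s, 2) * p ^ k' * u ^ 2 + w * p ^ k' * p ^ k' * p * u ^ 3)).
  rewrite !expnS; ring.
by rewrite dvdn_addl ?(dvdn_mulr _ (dvdnn p)) // Euclid_dvdM // negb_or pNs.
Qed.

Lemma expn_1mod_pX (k u e : nat) : 0 < k -> ~~ (p %| u) ->
  exists2 u', (1 + p ^ k * u) ^ (p ^ e) = 1 + p ^ (k + e) * u' & ~~ (p %| u').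
Proof.
move=> k_gt0 pNu; elim: e => [|e [u' IHe pNu']].
  by exists u; rewrite // expn0 expn1 addn0.
rewrite expnSr expnM IHe addnS; apply: expn_1mod_step => //.
by rewrite addn_gt0 k_gt0.
Qed.

(** Write s = s' p^e with s' prime to p. The power p^e raises the level k to k + e and s' preserves
    it, so (1 + p^k u)^s - 1 has valuation exactly k + e. *)
Lemma expn_1mod_order (k u M s : nat) : 0 < k -> ~~ (p %| u) ->
  (1 + p ^ k * u) ^ s = 1 %[mod p ^ M] -> p ^ (M - k) %| s.
Proof.
move=> k_gt0 pNu /eqP; have [-> | s_gt0] := posnP s; first by rewrite dvdn0.
have [s' pNs' ->] := pfactor_coprime p_prime s_gt0; set e := logn p s.
have [u1 E1 pNu1] := expn_1mod_pX e k_gt0 pNu.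
rewrite (mulnC s') expnM E1.
have [||u2 -> pNu2] := @expn_1mod_coprime (k + e) u1 s' _ pNu1.
- by rewrite addn_gt0 k_gt0.
- by rewrite -prime_coprime.
rewrite -{2}(addn0 1) eqn_modDl mod0n -/(dvdn _ _) => dvd.
apply: dvdn_mulr; apply: dvdn_exp2l; rewrite leq_subLR.
have u2_gt0: 0 < u2 by case: u2 pNu2 {dvd}; rewrite ?dvdn0.
have pk_gt0 : 0 < p ^ (k + e) by rewrite expn_gt0 (prime_gt0 p_prime).
move: dvd; rewrite pfactor_dvdn ?muln_gt0 ?pk_gt0 // lognM // pfactorK //.
by rewrite logn_coprime ?addn0 // prime_coprime.
Qed.

(** Times p^k, the geometric sum becomes (1 + p^k)^(p^r) - 1, whose valuation is exactly k + r. *)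
Lemma expn_1mod_sum (k r : nat) : 0 < k ->
  exists2 u, \sum_(s < p ^ r) (1 + p ^ k) ^ s = p ^ r * u & ~~ (p %| u).
Proof.
move=> k_gt0.
have pN1 : ~~ (p %| 1) by rewrite dvdn1 neq_ltn prime_gt1 ?orbT.
have [u E pNu] := expn_1mod_pX r k_gt0 pN1; rewrite muln1 in E.
exists u => //; apply/eqP; rewrite -(eqn_pmul2l (m := p ^ k)) ?expn_gt0
  ?prime_gt0 //.
rewrite mulnA -expnD -(eqn_add2l 1) -E.
have -> // : forall n,
  1 + p ^ k * \sum_(s < n) (1 + p ^ k) ^ s = (1 + p ^ k) ^ n.
elim=> [|n IHn]; first by rewrite big_ord0 muln0.
by rewrite big_ord_recr /= mulnDr addnA IHn expnS mulnDl mul1n.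
Qed.

(** Lifting by induction on M. With q = 1 + p^k u, q^(p^(M-k)) = 1 + p^M u' where u' is prime to p,
    so adding p^(M-k) e to the exponent s shifts q^s by p^M (q^s u' e) modulo p^(M+1), and e can be
    chosen to reach a. *)
Lemma expn_1mod_surj (k u M a : nat) : 0 < k -> ~~ (p %| u) ->
  a = 1 %[mod p ^ k] -> exists s, (1 + p ^ k * u) ^ s = a %[mod p ^ M].
Proof.
move=> k_gt0 pNu a1; have p_gt0 := prime_gt0 p_prime.
have [leMk | /ltnW leMk] := leqP M k.
  by exists 0; rewrite expn0 -(modn_dvdm a (dvdn_exp2l p leMk)) a1 modn_dvdm
    ?dvdn_exp2l.
elim: M leMk => [|M IHM]; first by exists 0; rewrite !modn1.
rewrite leq_eqVlt => /predU1P[<- | ltkM]; first by exists 0; rewrite expn0 a1.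
have {IHM} [s] := IHM ltkM; set q := 1 + p ^ k * u => qs_a.
(* The added multiple of p^(M+1) keeps the class of a and makes [a' - q ^ s] an untruncated
   subtraction. *)
pose a' := a + p ^ M.+1 * q ^ s.
have le_a' : q ^ s <= a' by rewrite (leq_trans _ (leq_addl _ _)) //
  leq_pmull ?expn_gt0 ?p_gt0.
have [c def_a'] : exists c, a' = q ^ s + p ^ M * c.
  have /dvdnP[c def_c] : p ^ M %| a' - q ^ s.
    by rewrite -eqn_mod_dvd // /a' expnSr -mulnA (mulnC (p ^ M)) addnC modnMDl
      qs_a.
  by exists c; rewrite mulnC -def_c subnKC.
have [u' defq pNu'] := expn_1mod_pX (M - k) k_gt0 pNu.
rewrite -/q subnKC // in defq.
have pNq : ~~ (p %| q ^ s).
  rewrite Euclid_dvdX // negb_and; apply/orP; left.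
  by rewrite /q -(prednK k_gt0) expnS -mulnA dvdn_addl ?dvdn_mulr //
    dvdn1 neq_ltn prime_gt1 ?orbT.
pose z := q ^ s * u'.
have coz : coprime z p by rewrite coprime_sym prime_coprime // Euclid_dvdM //
  negb_or pNq.
(* The Chinese remainder gives a multiple of z congruent to c modulo p; e is its quotient by z. *)
have [e def_e] : exists e, z * e = c %[mod p].
  exists (chinese z p 0 c %/ z); rewrite mulnC divnK ?chinese_modr //.
  by rewrite /dvdn chinese_modl // mod0n.
exists (s + p ^ (M - k) * e); rewrite expnD expnM -/q defq.
have [w ->] := binomial_expansion3 (p ^ M * u') e.
(* As M > 0, the terms of degree 2 and 3 are multiples of p^(M+1). *)
have [M' defM] : exists M', M = M'.+1 by exists M.-1;
  rewrite prednK // (leq_trans k_gt0).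
have -> : q ^ s * (1 + e * (p ^ M * u') + 'C(e, 2) * (p ^ M * u') ^ 2
                   + w * (p ^ M * u') ^ 3)
  = (q ^ s * ('C(e, 2) * p ^ M' * u' ^ 2 + w * p ^ M' * p ^ M * u' ^ 3))
      * p ^ M.+1
    + (q ^ s + p ^ M * (z * e)) by rewrite /z defM !expnS; ring.
rewrite modnMDl.
have -> : a = a' %[mod p ^ M.+1] by rewrite /a' (mulnC (p ^ _)) addnC modnMDl.
apply/eqP; rewrite def_a' eqn_modDl expnSr -!muln_modr; apply/eqP;
  congr (_ * _).
exact: def_e.
Qed.

End PrincipalUnits.

Import GroupScope GRing.Theory Num.Theory.

Section Representations.

Local Open Scope ring_scope.

(** * Intertwiners and multiplicities *)

Definition intertwines (F : fieldType) (gT : finGroupType) (G : {group gT})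
    (m d : nat) (sigma : mx_representation F G m)
    (rho : mx_representation F G d) (T : 'M[F]_(m, d)) : Prop :=
  {in G, forall x, sigma x *m T = T *m rho x}.

Lemma pchar_num_group (C : numFieldType) (gT : finGroupType) (G : {group gT}) :
  [pchar C]^'.-group G.
Proof. by rewrite /pgroup pcharf'_nat pnatr_eq0 -lt0n cardG_gt0. Qed.

(** T projects onto U along V, then applies the isomorphism to rho. *)
Lemma intertwiner_of_summand (F : fieldType) (gT : finGroupType)
    (G : {group gT}) (m d : nat) (sigma : mx_representation F G m)
    (rho : mx_representation F G d) (U V : 'M[F]_m)
    (modU : mxmodule sigma U) (modV : mxmodule sigma V) :
    U != 0 -> (U + V :=: 1%:M)%MS -> mxdirect (U + V) ->
    mx_rsim (submod_repr modU) rho ->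
  exists T, [/\ intertwines sigma rho T, U *m T != 0 & V *m T = 0].
Proof.
move=> nzU defUV dxUV [B _ Bfree homB]; have dUV := mxdirect_addsP dxUV.
exists (in_submod U (proj_mx U V) *m B); split.
- move=> x Gx; have := proj_mx_hom dUV modU modV.
  rewrite defUV => /hom_mxP/(_ x Gx); rewrite !mul1mx => homP.
  have sPU: (proj_mx U V <= U)%MS by rewrite -[X in (X <= _)%MS]mul1mx
    proj_mx_sub.
  have [P defP] : exists P, P = proj_mx U V by exists (proj_mx U V).
  rewrite -defP in homP sPU *.
  have -> : in_submod U P *m B *m rho x =
      in_submod U P *m submod_repr modU x *m B.
    by rewrite -[LHS]mulmxA -homB // [LHS]mulmxA.
  rewrite -(in_submodJ modU) // -homP mulmxA.
  by congr (_ *m B); rewrite /in_submod /= !mulmxA.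
- have -> : U *m (in_submod U (proj_mx U V) *m B) =
      in_submod U (U *m proj_mx U V) *m B.
    by rewrite mulmxA /in_submod /= !mulmxA.
  rewrite proj_mx_id //.
  have -> : (in_submod U U *m B == 0) = (in_submod U U == 0).
    by apply/idP/idP=> [|/eqP->];
      rewrite ?mul0mx // -{1}(mul0mx _ B) (inj_eq (row_free_inj Bfree)).
  by rewrite -val_submod_eq0 in_submodK.
have -> : V *m (in_submod U (proj_mx U V) *m B) =
    in_submod U (V *m proj_mx U V) *m B.
  by rewrite mulmxA /in_submod /= !mulmxA.
by rewrite proj_mx_0 // linear0 mul0mx.
Qed.

Lemma val_submod_intertwines (F : fieldType) (gT : finGroupType)
    (G : {group gT}) (m : nat) (sigma : mx_representation F G m) (U : 'M[F]_m)
    (modU : mxmodule sigma U) :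
  intertwines (submod_repr modU) sigma (val_submod 1%:M).
Proof.
by move=> x Gx; rewrite -(val_submodJ modU) // mul1mx [RHS]val_submodE.
Qed.

(** Used to see that a rational vector generating sigma still generates its complexification. *)
Lemma map_cyclic_mx (F K : fieldType) (f : {rmorphism F -> K})
    (gT : finGroupType) (G : {group gT}) (m : nat)
    (sigma : mx_representation F G m) (w : 'rV[F]_m) :
  (map_mx f (cyclic_mx sigma w) :=:
     cyclic_mx (map_repr f sigma) (map_mx f w))%MS.
Proof.
apply: eqmx_trans (map_genmx _ _) _; apply: eqmx_trans _ (eqmx_sym (genmxE _)).
rewrite map_mxM map_enveloping_algebra_mx.
have -> : map_mx f (lin_mul_row w) = lin_mul_row (map_mx f w) :> 'M_(m * m, m).
  by apply: map_lin1_mx => v /=; rewrite map_mxM map_vec_mx.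
exact: genmxE.
Qed.

(** Count dimensions: the hypotheses make the rank of U + V + W the sum of the three ranks. *)
Lemma capmx_adds_eq0 (F : fieldType) (m : nat) (U V W : 'M[F]_m) :
  (U :&: V = 0)%MS -> ((U + V) :&: W = 0)%MS -> (U :&: (V + W) = 0)%MS.
Proof.
move=> dUV dUVW; apply/eqP.
rewrite -mxrank_eq0 -leqn0 -(leq_add2l (\rank (U + (V + W))%MS)) addn0.
rewrite mxrank_sum_cap addsmxA (mxrank_disjoint_sum dUVW).
by rewrite (mxrank_disjoint_sum dUV) -addnA leq_add2l mxrank_adds_leqif.
Qed.

Section Constituents.

Variables (C : numClosedFieldType) (gT : finGroupType) (G : {group gT}).
Variables (d : nat) (rho : mx_representation C G d).
Variables (m : nat) (sigma : mx_representation C G m).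

Lemma constituentP :
  constituent rho sigma ->
  exists2 W : DecSocleType sigma, mx_rsim (socle_repr W) rho
    & multiplicity rho sigma = socle_mult W.
Proof.
rewrite /constituent /multiplicity lt0n sum_nat_eq0 negb_forall.
case/existsP=> W; rewrite negb_imply => /andP[/asboolP rsimW _]; exists W => //.
rewrite (bigD1 W) /=; last exact/asboolP.
rewrite big1 ?addn0 // => W' /andP[/asboolP rsimW' /eqP[]].
apply/eqP/socle_rsimP; exact: mx_rsim_trans rsimW' (mx_rsim_sym rsimW).
Qed.

(** The isotypic component of rho contains two independent copies U and V of rho; T1 is nonzero on
    U, while T2 is nonzero on V and kills U. Hence T2 is not a scalar multiple of T1. *)
Lemma multiple_constituent_intertwiners :
    (1 < multiplicity rho sigma)%N ->
  exists T1 T2 (U : 'M_m),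
    [/\ intertwines sigma rho T1, intertwines sigma rho T2,
    U *m T1 != 0, U *m T2 = 0 & T2 != 0].
Proof.
move=> mult_gt1; have [|W rsimW defm] := constituentP; first exact: ltnW.
have simU := socle_simple W; have [modU nzU _] := simU.
set U := socle_base W in simU modU nzU;
  have redS := mx_Maschke_pchar sigma (pchar_num_group C G).
(* The multiplicity is the quotient of the rank of W by that of U. *)
have ltUW : (\rank U < \rank W)%N.
  rewrite ltnNge; apply: contraL mult_gt1 => leWU; rewrite -leqNgt defm.
  by apply: leq_trans (leq_div2r _ leWU) _; rewrite divnn leq_b1.
have sUW: (U <= W)%MS by apply: component_mx_id.
have modW : mxmodule sigma W by apply: component_mx_module.
have [U' modU' defW dxU'] := mx_reducibleS modW (submx1 _) redS modU sUW.
have nzU' : U' != 0.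
  apply: contraTneq ltUW => U'0; by rewrite -leqNgt -defW U'0 addsmx0.
have [V simV sVU'] := dec_mxsimple_exists modU' nzU'.
have [modV nzV _] := simV.
have isoUV: mx_iso sigma U V.
  by apply: component_mx_iso => //;
    rewrite -/U (submx_trans sVU') // -defW addsmxSr.
have rsimV: mx_rsim (submod_repr modV) rho.
  by apply: mx_rsim_trans rsimW; apply: mx_rsim_sym; apply/mx_rsim_iso.
have dxUV : mxdirect (U + V).
  apply/mxdirect_addsP/eqP; rewrite -submx0 -(mxdirect_addsP dxU').
  by rewrite capmxS.
have modUV: mxmodule sigma (U + V)%MS by apply: addsmx_module.
have [Z modZ defZ dxZ] := redS _ modUV (submx1 _).
have [T2 [homT2 nzT2 UT2]] : exists T,
  [/\ intertwines sigma rho T, V *m T != 0 & (U + Z)%MS *m T = 0].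
  apply: (intertwiner_of_summand _ nzV) rsimV.
  - exact: addsmx_module.
  - by rewrite addsmxA (addsmxC V U).
  - apply/mxdirect_addsP/capmx_adds_eq0;
      first by rewrite capmxC (mxdirect_addsP dxUV).
    by rewrite (addsmxC V U) (mxdirect_addsP dxZ).
have [T1 [homT1 nzT1 _]] : exists T,
  [/\ intertwines sigma rho T, U *m T != 0 & (V + Z)%MS *m T = 0].
  apply: (intertwiner_of_summand _ nzU) rsimW.
  - exact: addsmx_module.
  - by rewrite addsmxA.
  - by apply/mxdirect_addsP/capmx_adds_eq0; apply/mxdirect_addsP.
exists T1, T2, U; split=> //; last by apply: contraNneq nzT2 => ->;
  rewrite mulmx0.
have /submxP[D ->] : (U <= U + Z)%MS by apply: addsmxSl.
by rewrite -mulmxA UT2 mulmx0.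
Qed.

Lemma irreducible_intertwiner_full (T : 'M_(m, d)) :
  mx_irreducible rho -> intertwines sigma rho T -> T != 0 -> row_full T.
Proof.
move=> irr homT nzT; have [_ /(_ <<T>>%MS)] := (mx_irrP _).1 irr.
have modT: mxmodule rho T.
  by apply/mxmoduleP=> x Gx; rewrite -homT // submxMl.
by rewrite (eqmx_module _ (genmxE _)) -mxrank_eq0 genmxE mxrank_eq0 /row_full
  genmxE; apply.
Qed.

(** By Maschke's theorem the kernel of T has an invariant complement, which T maps isomorphically
    onto rho. *)
Lemma intertwiner_constituent (T : 'M_(m, d)) :
  mx_irreducible rho -> intertwines sigma rho T -> T != 0 ->
  constituent rho sigma.
Proof.
move=> irr homT nzT.
have fullT : \rank T = d by apply/eqP; apply: irreducible_intertwiner_full.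
have modK : mxmodule sigma (kermx T).
  apply/mxmoduleP=> x Gx; apply/sub_kermxP.
  by rewrite -mulmxA homT // mulmxA mulmx_ker mul0mx.
have redS := mx_Maschke_pchar sigma (pchar_num_group C G).
have [V modV defV dxV] := redS _ modK (submx1 _).
have rankV : \rank V = d.
  have := mxrank_disjoint_sum (mxdirect_addsP dxV).
  rewrite defV mxrank1 mxrank_ker fullT => /(congr1 (addn d)).
  rewrite addnA subnKC; last by rewrite -fullT rank_leq_row.
  by rewrite addnC => /addnI.
have rsimV: mx_rsim (submod_repr modV) rho.
  exists (val_submod 1%:M *m T) => //.
    have /eqP/mxrank_injP :
        (val_submod (1%:M : 'M_(\rank V)) :&: kermx T = 0)%MS.
      apply/eqP; rewrite -submx0 -(mxdirect_addsP dxV) capmxC capmxS //.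
      by rewrite (val_submod1 V).
    by rewrite /row_free => ->; rewrite (val_submod1 V).
  move=> x Gx; rewrite -[RHS]mulmxA -homT // [LHS]mulmxA [RHS]mulmxA.
  by rewrite (val_submod_intertwines modV).
have simV: mxsimple sigma V.
  by apply/submod_mx_irr; apply: mx_rsim_irr irr; apply: mx_rsim_sym rsimV.
have [W isoW] := Socle_iso (DecSocleType sigma) simV.
have rsimW: mx_rsim (socle_repr W) rho.
  by apply: mx_rsim_trans rsimV; apply/mx_rsim_iso.
rewrite /constituent /multiplicity (bigD1 W) /=; last exact/asboolP.
rewrite addn_gt0; apply/orP; left.
have simW := socle_simple W; have [_ nzW _] := simW.
by rewrite /socle_mult divn_gt0 ?lt0n ?mxrank_eq0 ?mxrankS ?component_mx_id.
Qed.

(** Summing the translates by H of a preimage of a fixed vector v gives a fixed vector with image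
    |H| v, nonzero in characteristic 0. *)
Lemma rfix_mx_lift (T : 'M_(m, d)) (H : {group gT}) :
    H \subset G -> intertwines sigma rho T -> row_full T ->
  rfix_mx rho H != 0 -> rfix_mx sigma H != 0.
Proof.
move=> sHG homT fullT /rowV0Pn[v /rfix_mxP fixv nzv].
have /submxP[u def_v] : (v <= T)%MS by apply: submx_full.
pose w := \sum_(h in H) u *m sigma h.
have fixw : (w <= rfix_mx sigma H)%MS.
  apply/rfix_mxP=> h Hh; rewrite /w mulmx_suml.
  rewrite [RHS](reindex_acts 'R _ Hh) ?astabsR //=.
  by apply: eq_bigr => k Hk; rewrite -mulmxA -repr_mxM ?(fintype.subsetP sHG).
apply: contraNneq nzv => fix0.
have : w *m T = #|H|%:R *: v.
  rewrite mulmx_suml (eq_bigr (fun _ => v)) => [|h Hh].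
    by rewrite sumr_const scaler_nat.
  by rewrite -mulmxA homT ?(fintype.subsetP sHG) // mulmxA -def_v fixv.
move: fixw; rewrite fix0 submx0 => /eqP->; rewrite mul0mx => /esym/eqP.
by rewrite scaler_eq0 pnatr_eq0 eqn0Ngt cardG_gt0.
Qed.

End Constituents.

(** * Schur index 1 from a subgroup fixing exactly one line *)

Section SchurIndexOne.

Variables (C : numClosedFieldType) (gT : finGroupType) (G : {group gT}).
Variables (d : nat) (rho : mx_representation C G d).
Hypothesis rho_irr : mx_irreducible rho.

Local Notation toC := (map_mx (ratr : {rmorphism rat -> C})).

Lemma intertwiner_eq0 (m : nat) (sigma : mx_representation rat G m)
    (w : 'rV[rat]_m) (T : 'M[C]_(m, d)) :
    mx_irreducible sigma -> intertwines (complexification C sigma) rho T ->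
  w != 0 -> toC w *m T = 0 -> T = 0.
Proof.
move=> irr homT nzw wT0.
have genw : (1%:M <= cyclic_mx sigma w)%MS.
  by rewrite -(mxsimple_cyclic irr nzw) ?submx1.
have modK : mxmodule (complexification C sigma) (kermx T).
  apply/mxmoduleP=> x Gx; apply/sub_kermxP.
  by rewrite -mulmxA homT // mulmxA mulmx_ker mul0mx.
have cycK := cyclic_mx_sub modK (introT sub_kermxP wT0).
rewrite -map_cyclic_mx in cycK.
have /sub_kermxP: (1%:M <= kermx T)%MS.
  by rewrite -(map_mx1 (ratr : {rmorphism rat -> C})) (submx_trans _ cycK)
    ?map_submx.
by rewrite mul1mx.
Qed.

(** rho is a quotient of the regular representation, which is defined over the rationals. If rho
    were a constituent of none of its simple rational summands, the map onto rho would vanish on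
    each of them, hence everywhere. *)
Lemma rational_constituent :
  exists (m : nat) (sigma : mx_representation rat G m),
    mx_irreducible sigma /\ constituent rho (complexification C sigma).
Proof.
have pG := pchar_num_group C G.
have [U [modU rsimU]] := rsim_regular_submod_pchar rho_irr pG.
have nzU : U != 0.
  by have [d_gt0 _] := (mx_irrP _).1 rho_irr;
    rewrite -mxrank_eq0 -(mxrank_rsim rsimU) -lt0n.
have [V modV defV dxV] := mx_Maschke_pchar _ pG modU (submx1 _).
have [T [homT nzT _]] := intertwiner_of_summand modV nzU defV dxV (mx_rsim_sym
  rsimU).
have {}nzT : T != 0 by apply: contraNneq nzT => ->; rewrite mulmx0.
apply: contrapT => noconst.
(* Semisimplicity comes as a [classically] statement, usable only towards a boolean goal. *)
suff: false by [].
apply: (mx_reducible_semisimple (mxmodule1 (regular_repr rat G))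
  (mx_Maschke_pchar _ (pchar_num_group rat G))) => -[I W S simW defW _].
have zero i : toC (W i) *m T = 0.
  have modW := mxsimple_module (simW i).
  have irrW : mx_irreducible (submod_repr modW) by apply/submod_mx_irr.
  apply: contrapT => /eqP nz; apply: noconst.
  exists (\rank (W i)), (submod_repr modW); split=> //.
  apply: (@intertwiner_constituent _ _ _ _ _ _ _ (toC (val_submod (1%:M :
    'M_(\rank (W i)))) *m T)) => //.
    move=> x Gx; rewrite -[RHS]mulmxA -homT //.
    rewrite -(map_regular_repr (ratr : {rmorphism rat -> C})).
    by rewrite [LHS]mulmxA [RHS]mulmxA -!map_mxM (val_submod_intertwines modW).
  apply: contra_neq nz => valT0.
  have /submxP[D ->] : (W i <= val_submod (1%:M : 'M_(\rank (W i))))%MS by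
    rewrite val_submod1.
  by rewrite map_mxM -mulmxA valT0 mulmx0.
suff /sub_kermxP T0 : (1%:M <= kermx T)%MS by rewrite mul1mx in T0;
  rewrite T0 eqxx in nzT.
rewrite -(map_mx1 (ratr : {rmorphism rat -> C})).
apply: (@submx_trans _ _ _ _ _ _ (toC (\sum_i W i)%MS));
  first by rewrite map_submx defW.
have [D ->] := sub_sumsmxP (submx_refl (\sum_i W i)%MS).
rewrite raddf_sum /=; apply: summx_sub => i _.
by apply/sub_kermxP; rewrite map_mxM -mulmxA zero mulmx0.
Qed.

Theorem schur_index_eq1 (H : {group gT}) :
  H \subset G -> \rank (rfix_mx rho H) = 1%N -> schur_index rho = 1%N.
Proof.
move=> sHG rank1.
have uniq m (sigma : mx_representation rat G m) : mx_irreducible sigma ->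
    constituent rho (complexification C sigma) ->
  multiplicity rho (complexification C sigma) = 1%N.
  move=> irr const; apply/eqP; rewrite eqn_leq [(0 < _)%N]const andbT leqNgt;
    apply/negP.
  case/multiple_constituent_intertwiners=> T1 [T2 [U [hom1 hom2 nz1 zero2
    nz2]]].
  have nzT1: T1 != 0 by apply: contraNneq nz1 => ->; rewrite mulmx0.
  have full1 := irreducible_intertwiner_full rho_irr hom1 nzT1.
  (* Fixed spaces commute with extension of scalars, so a nonzero complex fixed vector yields a
     nonzero rational one. *)
  have := rfix_mx_lift sHG hom1 full1; rewrite -mxrank_eq0 rank1 => /(_ isT).
  rewrite -map_rfix_mx map_mx_eq0 => /rowV0Pn[w fixw nzw].
  have fix_im T : intertwines (complexification C sigma) rho T ->
      (toC w *m T <= rfix_mx rho H)%MS.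
    move=> homT; apply/rfix_mxP=> h Hh.
    rewrite -mulmxA -homT ?(fintype.subsetP sHG) // mulmxA -map_mxM.
    by move/rfix_mxP: fixw => ->.
  have nz1w : toC w *m T1 != 0 by apply: contraNneq nzT1 => /(intertwiner_eq0
    irr hom1 nzw)->.
  have /submxP[c def_c]: (toC w *m T2 <= toC w *m T1)%MS.
    apply: submx_trans (fix_im _ hom2) _.
    rewrite -(geq_leqif (mxrank_leqif_sup (fix_im _ hom1))) rank1.
    by rewrite lt0n mxrank_eq0.
  have [a def_a] : exists a, c = a%:M by exists (c 0 0); apply: mx11_scalar.
  have T2E : T2 = a *: T1.
    apply/eqP; rewrite -subr_eq0; apply/eqP; apply: (intertwiner_eq0 irr _ nzw).
      by move=> x Gx; rewrite mulmxBr mulmxBl hom2 //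
        -scalemxAr -scalemxAl hom1.
    by rewrite mulmxBr def_c def_a mul_scalar_mx -scalemxAr subrr.
  have a0 : a = 0.
    move/eqP: zero2; rewrite T2E -scalemxAr scaler_eq0 (negPf nz1) orbF.
    by move/eqP.
  by rewrite T2E a0 scale0r eqxx in nz2.
apply: xget_unique => /= [|k [m [sigma [irr const ->]]]]; last exact: uniq.
have [m [sigma [irr const]]] := rational_constituent.
by exists m, sigma; rewrite uniq.
Qed.

End SchurIndexOne.

(** * Fixed lines by Mackey's formula *)

Section FixedLines.

Variables (C : numClosedFieldType) (gT : finGroupType) (G : {group gT}).
Variables (d : nat) (rho : mx_representation C G d).

(** Over an algebraically closed field, a simple submodule of U for an abelian group is a line. *)
Lemma abelian_eigenvector (B : {group gT}) (U : 'M[C]_d) :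
    B \subset G -> abelian B -> U != 0 ->
    {in B, forall b, (U *m rho b <= U)%MS} ->
  exists v : 'rV_d, [/\ v != 0, (v <= U)%MS
    & {in B, forall b, exists c, v *m rho b = c *: v}].
Proof.
move=> sBG abB nzU modU.
have modBU : mxmodule (subg_repr rho sBG) U by apply/mxmoduleP=> b Bb;
  apply: modU.
have [V simV sVU] := dec_mxsimple_exists modBU nzU.
have splitB : group_splitting_field C B by apply: group_closure_closed_field.
have rankV := mxsimple_abelian_linear splitB abB simV.
have [modV nzV _] := simV.
exists (nz_row V); split; rewrite ?nz_row_eq0 ?(submx_trans (nz_row_sub V)) //.
move=> b Bb; apply/sub_rVP.
have sV : (V <= nz_row V)%MS.
  by rewrite -(geq_leqif (mxrank_leqif_sup (nz_row_sub V))) rankV lt0n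
    mxrank_eq0 nz_row_eq0.
rewrite (submx_trans _ sV) // (submx_trans (submxMr _ (nz_row_sub V))) //.
by move/mxmoduleP: modV => /(_ b Bb).
Qed.

Lemma geometric_sum_root1 (eta : C) (N : nat) :
  eta ^+ N = 1 -> \sum_(l < N) eta ^+ l = if eta == 1 then N%:R else 0.
Proof.
move=> etaN; case: eqP => [-> | /eqP eta1].
  by rewrite (eq_bigr (fun=> 1)) ?sumr_const ?card_ord // => l _;
    rewrite expr1n.
have /eqP := subrX1 eta N; rewrite etaN subrr eq_sym mulf_eq0 subr_eq0 (negPf
  eta1).
by move/eqP.
Qed.

Lemma repr_mx_eigenX (k : nat) (W : 'M[C]_(k, d)) (x : gT) (zeta : C)
    (l : nat) :
  x \in G -> W *m rho x = zeta *: W -> W *m rho (x ^+ l)%g = zeta ^+ l *: W.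
Proof.
move=> Gx Wx; elim: l => [|l IHl];
  first by rewrite expg0 repr_mx1 mulmx1 scale1r.
by rewrite expgSr repr_mxM ?groupX // mulmxA IHl -scalemxAl Wx scalerA exprSr.
Qed.

Lemma scale_vec_inj (v : 'rV[C]_d) (b c : C) :
  v != 0 -> b *: v = c *: v -> b = c.
Proof.
move=> nzv /eqP; rewrite -subr_eq0 -scalerBl scaler_eq0 (negPf nzv) orbF
  subr_eq0.
by move/eqP.
Qed.

Section Mackey.

Variables (x : gT) (zeta : C) (v : 'rV[C]_d).
Hypotheses (rho_irr : mx_irreducible rho) (Gx : x \in G).
Hypotheses (nz_v : v != 0) (vx : v *m rho x = zeta *: v).

Variable H : {group gT}.
Hypothesis sHG : H \subset G.
(* With K the stabilizer of the line of v and chi its character, stabH says that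
   chi is trivial on the intersection of H and K, and doubleH that for y outside
   K H the conjugate of chi by y is nontrivial on the intersection of H and the
   conjugate of K by y: these are the terms of Mackey's formula. *)
Hypothesis stabH : {in H, forall h, exists2 j : nat,
  (h * x = x ^+ j * h)%g & zeta ^+ j = zeta -> v *m rho h = v}.
Hypothesis doubleH : {in G, forall y,
  (exists2 h, h \in H & exists c, v *m rho y = c *: (v *m rho h)) \/
  (exists2 h, h \in H &
     exists2 c, c != 1 & v *m rho (y * h)%g = c *: (v *m rho y))}.

Let e := \sum_(h in H) rho h.

Let mul_e h : h \in H -> rho h *m e = e.
Proof.
move=> Hh; rewrite /e mulmx_sumr [RHS](reindex_inj (mulgI h)) /=.
rewrite [RHS](eq_bigl (mem H)) => [|k]; last by rewrite /= groupMl.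
by apply: eq_bigr => k Hk; rewrite repr_mxM ?(fintype.subsetP sHG).
Qed.

Let e_mul h : h \in H -> e *m rho h = e.
Proof.
move=> Hh; rewrite /e mulmx_suml [RHS](reindex_inj (mulIg h)) /=.
rewrite [RHS](eq_bigl (mem H)) => [|k]; last by rewrite /= groupMr.
by apply: eq_bigr => k Hk; rewrite repr_mxM ?(fintype.subsetP sHG).
Qed.

Let rfix_sub_e : (rfix_mx rho H <= e)%MS.
Proof.
have : rfix_mx rho H *m e = #|H|%:R *: rfix_mx rho H.
  rewrite mulmx_sumr (eq_bigr (fun=> rfix_mx rho H)) => [|h Hh].
    by rewrite sumr_const scaler_nat.
  exact: rfix_mx_id.
have nzH : #|H|%:R != 0 :> C by rewrite pnatr_eq0 -lt0n cardG_gt0.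
by move=> fixe; rewrite -[X in (X <= _)%MS](scalerK nzH) -fixe scalemx_sub
  ?submxMl.
Qed.

(** The vectors v y span rho. In the first case of [doubleH], v y e is a multiple of v h e = v e; in
    the second, v y e = v y h e = c (v y e) with c != 1, so v y e = 0. [M] is e modulo the line of v
    e. *)
Let e_sub_ve : (e <= v *m e)%MS.
Proof.
rewrite submxE; set K := cokermx _; set M := e *m K.
have vM0 : v *m M = 0 by rewrite mulmxA mulmx_coker.
have hM h : h \in H -> rho h *m M = M by move=> Hh; rewrite mulmxA mul_e.
have vyM0 y : y \in G -> v *m rho y *m M = 0.
  move=> Gy; case: (doubleH Gy) => [[h Hh [c ->]] | [h Hh [c c1 def_c]]].
    by rewrite -scalemxAl -(mulmxA v) hM // vM0 scaler0.
  have : v *m rho (y * h)%g *m M = v *m rho y *m M.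
    by rewrite repr_mxM ?(fintype.subsetP sHG _ Hh) // -!mulmxA hM.
  rewrite def_c -scalemxAl => /eqP.
  rewrite -subr_eq0 -[X in _ - X]scale1r -scalerBl scaler_eq0 subr_eq0 (negPf
    c1).
  by move/eqP.
suff /sub_kermxP : (1%:M <= kermx M)%MS by rewrite mul1mx => ->.
apply: (@submx_trans _ _ _ _ _ _ (cyclic_mx rho v)).
  by rewrite -(mxsimple_cyclic rho_irr nz_v) ?submx1.
rewrite genmxE; apply/row_subP=> i; apply/sub_kermxP.
by rewrite row_mul rowK mul_rV_lin1 /= mxvecK vyM0 ?enum_valP.
Qed.

Let ve_neq0 : v *m e != 0.
Proof.
(* Up to the factor N, E projects onto the zeta-eigenspace of x. *)
set N := #[x]%g; pose E := \sum_(l < N) zeta ^- l *: rho (x ^+ l)%g.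
have nz_zeta : zeta != 0.
  apply: contraNneq nz_v => zeta0; move: vx; rewrite zeta0 scale0r.
  by move/(congr1 (mulmx^~ (rho x^-1)%g));
    rewrite /= mul0mx -mulmxA -repr_mxM ?groupV // mulgV repr_mx1 mulmx1 => ->.
have zetaN : zeta ^+ N = 1.
  apply: (scale_vec_inj nz_v).
  by rewrite -(repr_mx_eigenX N Gx vx) expg_order repr_mx1 mulmx1 scale1r.
(* v h is an eigenvector of x for zeta^j. It is killed by E unless zeta^j = zeta, and then [stabH]
   gives v h = v. *)
have vhE h : h \in H -> v *m rho h *m E = 0 \/ v *m rho h *m E = N%:R *: v.
  move=> Hh; have Gh := fintype.subsetP sHG _ Hh; have [j hx stab] := stabH Hh.
  have hxX l : (h * x ^+ l = x ^+ (j * l) * h)%g.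
    elim: l => [|l IHl]; first by rewrite muln0 mulg1 mul1g.
    by rewrite expgSr mulgA IHl -mulgA hx mulgA -expgD mulnS addnC.
  have -> : v *m rho h *m E = (\sum_(l < N) (zeta ^+ j / zeta) ^+ l)
      *: (v *m rho h).
    rewrite mulmx_sumr scaler_suml; apply: eq_bigr => l _.
    rewrite -scalemxAr -mulmxA -repr_mxM ?groupX // hxX repr_mxM ?groupX //
      mulmxA.
    rewrite (repr_mx_eigenX _ Gx vx) -scalemxAl scalerA; congr (_ *: _).
    by rewrite expr_div_n exprM mulrC.
  rewrite geometric_sum_root1;
    last by rewrite expr_div_n -exprM mulnC exprM zetaN expr1n divr1.
  case: eqP => [/(canRL (mulfVK nz_zeta)) | _]; last by left; rewrite scale0r.
  by rewrite mul1r => /stab->; right.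
pose n h := if v *m rho h *m E == 0 then 0%N else N.
have : v *m e *m E = (\sum_(h in H) n h)%:R *: v.
  rewrite [v *m e]mulmx_sumr mulmx_suml natr_sum scaler_suml;
    apply: eq_bigr => h Hh.
  rewrite /n; case: eqP => [->|nz]; first by rewrite scale0r.
  by case: (vhE h Hh).
apply: contra_eq_neq => ->;
  rewrite mul0mx eq_sym scaler_eq0 (negPf nz_v) orbF pnatr_eq0.
(* The terms are natural numbers, and h = 1 contributes N > 0. *)
rewrite -lt0n (bigD1 1%g) //= addn_gt0 {1}/n repr_mx1 mulmx1.
have -> : v *m E = N%:R *: v.
  rewrite mulmx_sumr (eq_bigr (fun=> v)) ?sumr_const ?card_ord ?scaler_nat //
    => l _.
  by rewrite -scalemxAr (repr_mx_eigenX _ Gx vx) scalerA mulVf ?scale1r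
    ?expf_neq0.
by rewrite scaler_eq0 (negPf nz_v) orbF pnatr_eq0 eqn0Ngt /N order_gt0 /=
  order_gt0.
Qed.

Lemma rank_rfix_mackey : \rank (rfix_mx rho H) = 1%N.
Proof.
apply/eqP; rewrite eqn_leq (leq_trans (mxrankS (submx_trans rfix_sub_e
  e_sub_ve))) ?rank_leq_row //.
rewrite lt0n mxrank_eq0; apply: contraNneq ve_neq0 => fix0.
have : (v *m e <= rfix_mx rho H)%MS by apply/rfix_mxP => h Hh;
  rewrite -mulmxA e_mul.
by rewrite fix0 submx0.
Qed.

End Mackey.
End FixedLines.

(** * Groups with the structure of the holomorph of a cyclic p-group *)

Section HolomorphLike.

Variables (p n : nat) (p_prime : prime p) (p_odd : odd p).
Variables (gT : finGroupType) (G A : {group gT}) (x : gT).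
Hypotheses (Gx : x \in G) (xpn : (x ^+ (p ^ n) = 1)%g).
Hypotheses (sAG : A \subset G) (abA : abelian A).
Hypothesis decG :
  {in G, forall y, exists i, exists2 a, a \in A & y = (x ^+ i * a)%g}.
Hypothesis actA : {in A, forall a, exists j, (a * x = x ^+ j * a)%g}.
Hypothesis fullA : forall j,
  coprime p j -> exists2 a, a \in A & (a * x = x ^+ j * a)%g.
Hypothesis faithfulA : {in A, forall a, (a * x = x * a)%g -> a = 1%g}.

Lemma twist_X (a : gT) (j l : nat) :
  (a * x = x ^+ j * a)%g -> (a * x ^+ l = x ^+ (j * l) * a)%g.
Proof.
move=> ax; elim: l => [|l IHl]; first by rewrite muln0 mulg1 mul1g.
by rewrite expgSr mulgA IHl -mulgA ax mulgA -expgD mulnS addnC.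
Qed.

Lemma twist_expg (a : gT) (j s : nat) :
  (a * x = x ^+ j * a)%g -> (a ^+ s * x = x ^+ (j ^ s)%N * a ^+ s)%g.
Proof.
move=> ax; elim: s => [|s IHs]; first by rewrite !expg0 mul1g mulg1 expg1.
by rewrite expgSr -mulgA ax mulgA (twist_X _ IHs) -mulgA expnSr.
Qed.

(** By faithfulness, identities in A can be checked on exponents modulo p^n. *)
Lemma twist_inj (a b : gT) (j k : nat) : a \in A -> b \in A ->
    (a * x = x ^+ j * a)%g -> (b * x = x ^+ k * b)%g -> j = k %[mod p ^ n] ->
  a = b.
Proof.
move=> Aa Ab ax bx eqjk.
have eqx : (x ^+ j = x ^+ k)%g by rewrite -(expg_mod j xpn) eqjk expg_mod.
suff /(mulg1_eq) : (a^-1 * b = 1)%g by rewrite invgK.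
apply: faithfulA; first by rewrite groupM ?groupV.
by rewrite -mulgA bx -eqx !mulgA; congr (_ * b)%g; apply: (mulgI a);
  rewrite !mulgA mulgV mul1g ax mulgK.
Qed.

Lemma act_G y : y \in G -> exists j, (y * x = x ^+ j * y)%g.
Proof.
case/decG=> i [a Aa ->]; have [j ax] := actA Aa; exists j.
by rewrite -mulgA ax !mulgA -!expgD addnC.
Qed.

Variables (C : numClosedFieldType) (d : nat) (rho : mx_representation C G d).
Hypothesis rho_irr : mx_irreducible rho.

Section Line.

Variables (zeta : C) (v : 'rV[C]_d).
Hypotheses (nz_v : v != 0) (vx : v *m rho x = zeta *: v).

(** As x^i only scales v, the double coset condition for y = x^i a need only be tested on a. *)
Lemma rank_rfix_line (H : {group gT}) : H \subset G ->
    {in H, forall h j, (h * x = x ^+ j * h)%g -> zeta ^+ j = zeta ->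
      v *m rho h = v} ->
    {in A, forall a,
      (exists2 h, h \in H & exists c, v *m rho a = c *: (v *m rho h)) \/
      (exists2 h, h \in H &
         exists2 c, c != 1 & v *m rho (a * h)%g = c *: (v *m rho a))} ->
  \rank (rfix_mx rho H) = 1%N.
Proof.
move=> sHG stabH doubleH; apply: (rank_rfix_mackey rho_irr Gx nz_v vx sHG).
  move=> h Hh; have [j hx] := act_G (fintype.subsetP sHG _ Hh).
  by exists j => //; apply: stabH Hh _ hx.
move=> y /decG[i [a Aa ->]]; have Ga := fintype.subsetP sAG _ Aa.
have viE g : g \in G -> v *m rho (x ^+ i * g)%g = zeta ^+ i *: (v *m rho g).
  by move=> Gg; rewrite repr_mxM ?groupX //
    mulmxA (repr_mx_eigenX _ Gx vx) scalemxAl.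
case: (doubleH a Aa) => [[h Hh [c vac]] | [h Hh [c c1 vac]]].
  by left; exists h => //; exists (zeta ^+ i * c); rewrite viE // vac scalerA.
right; exists h => //; exists c => //.
by rewrite -mulgA !viE ?groupM ?(fintype.subsetP sHG _ Hh) //
  vac !scalerA mulrC.
Qed.

End Line.

(** B preserves the zeta-eigenspace of x, because its exponents fix zeta, and has a common
    eigenvector there. *)
Lemma exists_eigenline (zeta : C) (u : 'rV[C]_d) (B : {group gT}) :
    u != 0 -> u *m rho x = zeta *: u -> B \subset G -> abelian B ->
    {in B, forall b, exists2 j, (b * x = x ^+ j * b)%g & zeta ^+ j = zeta} ->
  exists v : 'rV_d, [/\ v != 0, v *m rho x = zeta *: v
    & {in B, forall b, exists c, v *m rho b = c *: v}].
Proof.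
move=> nzu ux sBG abB stabB; set U := eigenspace (rho x) zeta.
have uU : (u <= U)%MS by apply/eigenspaceP.
have nzU : U != 0 by apply: contraNneq nzu => U0; rewrite U0 submx0 in uU.
have Ux : U *m rho x = zeta *: U by apply/eigenspaceP.
have [|v [nzv /eigenspaceP vU vB]] := @abelian_eigenvector _ _ _ _ rho _ _ sBG
  abB nzU; last by exists v.
move=> b Bb; have [j bx zj] := stabB b Bb; have Gb := fintype.subsetP sBG _ Bb.
apply/eigenspaceP; rewrite -mulmxA -repr_mxM // bx repr_mxM ?groupX // mulmxA.
by rewrite (repr_mx_eigenX _ Gx Ux) zj -[LHS]scalemxAl.
Qed.


(** * The choice of H for an eigenvalue of order p^m with m > 0 *)

Section PrimitiveLine.

Variables (m k : nat) (zeta eps : C) (v : 'rV[C]_d) (g : gT).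
Hypotheses (m_gt0 : (0 < m)%N) (zeta_prim : (p ^ m).-primitive_root zeta).
Hypotheses (Ag : g \in A) (gx : (g * x = x ^+ (1 + p ^ m) * g)%g).
Hypotheses (nz_v : v != 0) (vx : v *m rho x = zeta *: v).
Hypothesis vg : v *m rho g = eps *: v.
Hypothesis eps_prim : (p ^ k).-primitive_root eps.

Let inG a : a \in A -> a \in G. Proof. exact: (fintype.subsetP sAG). Qed.
Let Gg : g \in G := inG Ag.

(** zeta^j = zeta means that j is 1 modulo p^m, and the powers of 1 + p^m reach all such classes
    modulo p^n. *)
Lemma stab_line_expg (a : gT) (j : nat) : a \in A ->
  (a * x = x ^+ j * a)%g -> zeta ^+ j = zeta -> exists s, a = (g ^+ s)%g.
Proof.
move=> Aa ax /eqP; rewrite -{2}[zeta]expr1 (eq_prim_root_expr zeta_prim) =>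
  /eqP j1.
have pN1 : ~~ (p %| 1)%N by rewrite dvdn1 neq_ltn prime_gt1 ?orbT.
have [s] := expn_1mod_surj p_prime p_odd n m_gt0 pN1 j1; rewrite muln1 => qs_j.
by exists s; apply: twist_inj ax (twist_expg s gx) _; rewrite ?groupX.
Qed.

Lemma commA a b : a \in A -> b \in A -> (a * b = b * a)%g.
Proof. by move=> Aa Ab; apply: (centsP abA). Qed.

Lemma rank_rfix_large : (m <= k)%N ->
  exists2 H : {group gT}, H \subset G & \rank (rfix_mx rho H) = 1%N.
Proof.
move=> lemk; have zetaNk : zeta^-1 ^+ (p ^ k) = 1.
  rewrite exprVn; apply/eqP; rewrite invr_eq1 -(prim_order_dvd zeta_prim).
  exact: dvdn_exp2l.
have [[i _] /= def_z] := prim_rootP eps_prim zetaNk.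
have nz_z : zeta != 0 by rewrite (prim_root_eq0 zeta_prim) -lt0n expn_gt0
  prime_gt0.
set h := (x * g ^+ i)%g; have Gh : h \in G by rewrite groupM ?groupX.
have vh : v *m rho h = 1 *: v.
  rewrite repr_mxM ?groupX // mulmxA vx -scalemxAl (repr_mx_eigenX _ Gg vg).
  by rewrite scalerA -def_z mulfV.
exists <[h]>%G; first by rewrite cycle_subG.
apply: (rank_rfix_line nz_v vx); first by rewrite cycle_subG.
  by move=> _ /cycleP[s ->] j _ _;
    rewrite (repr_mx_eigenX _ Gh vh) expr1n scale1r.
move=> a Aa; have [j ax] := actA Aa; have Ga := inG Aa.
have [zj | zj] := eqVneq (zeta ^+ j) zeta.
  have [s ->] := stab_line_expg Aa ax zj; left; exists 1%g; first exact: group1.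
  by exists (eps ^+ s); rewrite repr_mx1 mulmx1 (repr_mx_eigenX _ Gg vg).
right; exists h; first exact: cycle_id.
(* Since A is abelian, a h = x^j g^i a, so h scales v a by zeta^j eps^i = zeta^j / zeta. *)
exists (zeta ^+ j / zeta).
  by apply: contra_neq zj => /(canRL (mulfVK nz_z)) ->; rewrite mul1r.
rewrite mulgA ax -mulgA (commA Aa) ?groupX //
  mulgA !repr_mxM ?groupM ?groupX //.
rewrite !mulmxA (repr_mx_eigenX _ Gx vx) -!scalemxAl (repr_mx_eigenX _ Gg vg).
by rewrite -!scalemxAl scalerA def_z.
Qed.

(** With H = A there is a single double coset <x> A, and eps = 1 makes the stabilizer of zeta in A
    act trivially on v. *)
Lemma rank_rfix_trivial : k = 0 ->
  exists2 H : {group gT}, H \subset G & \rank (rfix_mx rho H) = 1%N.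
Proof.
move=> k0; have eps1 : eps = 1 by have := prim_expr_order eps_prim; rewrite k0.
exists A => //; apply: (rank_rfix_line nz_v vx) => // [a Aa j ax zj | a Aa].
  have [s ->] := stab_line_expg Aa ax zj.
  by rewrite (repr_mx_eigenX _ Gg vg) eps1 expr1n scale1r.
by left; exists a => //; exists 1; rewrite scale1r.
Qed.

Lemma rank_rfix_small : (0 < k < m)%N ->
  exists2 H : {group gT}, H \subset G & \rank (rfix_mx rho H) = 1%N.
Proof.
case/andP=> k_gt0 ltkm; have p_gt0 := prime_gt0 p_prime.
have nz_z : zeta != 0 by rewrite (prim_root_eq0 zeta_prim) -lt0n expn_gt0
  prime_gt0.
have pN1 : ~~ (p %| 1)%N by rewrite dvdn1 neq_ltn prime_gt1 ?orbT.
set q := (1 + p ^ k)%N; set t := (p ^ (m - k))%N.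
have [b Ab bx] : exists2 b, b \in A & (b * x = x ^+ q * b)%g.
  by apply: fullA; rewrite prime_coprime //
    /q -(prednK k_gt0) expnS dvdn_addl ?dvdn_mulr.
have Gb := inG Ab; have bsx s := twist_expg s bx.
(* The exponent q^t = 1 + p^m u of b^t fixes zeta, so b^t is a power of g. *)
have [u def_qt pNu] := expn_1mod_pX p_prime p_odd (m - k) k_gt0 pN1.
rewrite muln1 -/q -/t subnKC ?(ltnW ltkm) // in def_qt.
have zqt : zeta ^+ (q ^ t) = zeta.
  by rewrite def_qt exprD expr1 exprM (prim_expr_order zeta_prim) expr1n mulr1.
have [s0 def_bt] := stab_line_expg (groupX t Ab) (bsx t) zqt.
pose delta := eps ^+ s0.
have vbt : v *m rho (b ^+ t)%g = delta *: v.
  by rewrite def_bt (repr_mx_eigenX _ Gg vg).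
(* Conversely g is a power of b^t, because u is prime to p. *)
have [s1 def_eps] : exists s1, eps = delta ^+ s1.
  have m1 : (1 + p ^ m = 1 %[mod p ^ m])%N by rewrite -modnDmr modnn addn0.
  have [s1 Es1] := expn_1mod_surj p_prime p_odd n m_gt0 pNu m1.
  exists s1; apply: (scale_vec_inj nz_v);
    rewrite -vg -(repr_mx_eigenX _ _ vbt) ?groupX //.
  congr (_ *m rho _); apply: twist_inj gx (twist_expg s1 (bsx t)) _;
    rewrite ?groupX //.
  by rewrite def_qt.
have [u2 def_N pNu2] := expn_1mod_sum p_prime p_odd (m - k) k_gt0.
rewrite -/q -/t in def_N; set N := (\sum_(s < t) q ^ s)%N in def_N.
have zN_prim : (p ^ k).-primitive_root (zeta ^+ N).
  have zt_prim : (p ^ k).-primitive_root (zeta ^+ t).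
    by rewrite /t expnB // ?(ltnW ltkm) // dvdn_prim_root // dvdn_exp2l // ltnW.
  by rewrite def_N exprM (prim_root_exp_coprime _ zt_prim) coprime_sym
    coprimeXl // prime_coprime.
have nz_delta : delta != 0.
  by rewrite expf_neq0 // (prim_root_eq0 eps_prim) -lt0n expn_gt0 p_gt0.
(* zeta^N has order p^k and delta^-1 has order dividing p^k; this choice of i makes h^t fix v. *)
have [i def_d] : exists i, delta^-1 = zeta ^+ (i * N).
  have deltaV : delta^-1 ^+ (p ^ k) = 1.
    by rewrite exprVn -exprM mulnC exprM (prim_expr_order eps_prim) expr1n
      invr1.
  by have [[i _] /= ->] := prim_rootP zN_prim deltaV; exists i;
    rewrite mulnC exprM.
set h := (x ^+ i * b)%g; have Gh : h \in G by rewrite groupM ?groupX.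
have hs s : (h ^+ s = x ^+ (i * \sum_(r < s) q ^ r)%N * b ^+ s)%g.
  elim: s => [|s IHs]; first by rewrite big_ord0 muln0 !expg0 mulg1.
  rewrite expgSr IHs big_ord_recr /= mulnDr expgD /h -!mulgA; congr (_ * _)%g.
  by rewrite !mulgA (twist_X i (bsx s)) -mulgA -expgSr mulnC.
have hsx s : (h ^+ s * x = x ^+ (q ^ s)%N * h ^+ s)%g.
  by rewrite hs -mulgA bsx !mulgA -!expgD addnC.
have vht : v *m rho (h ^+ t)%g = 1 *: v.
  rewrite hs -/N repr_mxM ?groupX // mulmxA (repr_mx_eigenX _ Gx vx) -def_d.
  by rewrite -scalemxAl vbt scalerA mulVf.
exists <[h]>%G; first by rewrite cycle_subG.
apply: (rank_rfix_line nz_v vx); first by rewrite cycle_subG.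
  move=> _ /cycleP[s ->] j hsx' zj.
  have zqs : zeta ^+ (q ^ s) = zeta.
    apply: (scale_vec_inj nz_v); rewrite -vx -(repr_mx_eigenX _ Gx vx).
    have -> : (x ^+ (q ^ s)%N = x ^+ j)%g by apply: (mulIg (h ^+ s)%g);
      rewrite -hsx -hsx'.
    by rewrite (repr_mx_eigenX _ Gx vx) zj vx.
  move/eqP: zqs; rewrite -{2}[zeta]expr1 (eq_prim_root_expr zeta_prim) => /eqP
    qs1.
  (* The elements of H whose exponent fixes zeta are the powers of h^t. *)
  have /dvdnP[l ->] : (t %| s)%N.
    by apply: (expn_1mod_order p_prime p_odd k_gt0 pN1); rewrite muln1.
  by rewrite mulnC expgM (repr_mx_eigenX _ _ vht) ?groupX // expr1n scale1r.
move=> a Aa; have [j ax] := actA Aa; have Ga := inG Aa.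
(* If delta^j = delta, then j is 1 modulo p^k, a is a power b^s and v a is proportional to v h^s.
   Otherwise a h^t = x^(j i N) b^t a, so h^t scales v a by delta^-j delta. *)
have [dj | dj] := eqVneq (delta ^+ j) delta.
  have j1 : (j = 1 %[mod p ^ k])%N.
    apply/eqP; rewrite -(eq_prim_root_expr eps_prim) expr1.
    by rewrite def_eps -exprM mulnC exprM dj.
  have [s] := expn_1mod_surj p_prime p_odd n k_gt0 pN1 j1;
    rewrite muln1 -/q => qs_j.
  have -> : a = (b ^+ s)%g by apply: twist_inj ax (bsx s) _; rewrite ?groupX.
  left; exists (h ^+ s)%g; first exact: mem_cycle.
  exists (zeta ^- (i * \sum_(r < s) q ^ r)%N).
  rewrite hs repr_mxM ?groupX // mulmxA (repr_mx_eigenX _ Gx vx) -scalemxAl.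
  by rewrite scalerA mulVf ?scale1r ?expf_neq0.
right; exists (h ^+ t)%g; first exact: mem_cycle.
exists (delta ^- j * delta).
  have nz_dj : delta ^+ j != 0 by rewrite expf_neq0.
  by apply: contra_neq dj => /(canRL (mulVKf nz_dj)) {2}->; rewrite mulr1.
rewrite hs -/N mulgA (twist_X _ ax) -mulgA (commA Aa) ?groupX // mulgA.
rewrite !repr_mxM ?groupM ?groupX // !mulmxA (repr_mx_eigenX _ Gx vx).
by rewrite -!scalemxAl vbt -!scalemxAl scalerA mulnC exprM -def_d exprVn.
Qed.

End PrimitiveLine.

Theorem exists_rank1_rfix :
  exists2 H : {group gT}, H \subset G & \rank (rfix_mx rho H) = 1%N.
Proof.
have p_gt0 := prime_gt0 p_prime.
have [zeta [u nzu ux]] : exists zeta,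
    exists2 u : 'rV_d, u != 0 & u *m rho x = zeta *: u.
  have [||||u [nzu _ /(_ x (cycle_id x))[z ux]]] := @abelian_eigenvector _ _ _
    _ rho <[x]>%G 1%:M.
  - by rewrite cycle_subG.
  - exact: cycle_abelian.
  - by case: rho_irr.
  - by move=> b _; apply: submx1.
  by exists z, u.
have zpn : zeta ^+ (p ^ n) = 1.
  apply: (scale_vec_inj nzu); rewrite -(repr_mx_eigenX _ Gx ux) xpn.
  by rewrite repr_mx1 mulmx1 scale1r.
have pn_gt0 : (0 < p ^ n)%N by rewrite expn_gt0 p_gt0.
have [r zeta_prim /dvdn_pfactor] := prim_order_exists pn_gt0 zpn.
case=> // m le_mn def_r; rewrite {r}def_r in zeta_prim.
(* For m = 0 all of A preserves the eigenspace of zeta = 1, so v spans a line stable under G. *)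
have [m0 | m_gt0] := posnP m.
  have z1 : zeta = 1 by have := prim_expr_order zeta_prim; rewrite m0.
  have [|v [nzv vx vA]] := exists_eigenline nzu ux sAG abA.
    by move=> a /actA[j ax]; exists j; rewrite // z1 expr1n.
  exists 1%G; first exact: sub1G.
  apply: (rank_rfix_line nzv vx); first exact: sub1G.
    by move=> h /set1P-> j _ _; rewrite repr_mx1 mulmx1.
  move=> a Aa; left; exists 1%g; first exact: group1.
  by have [c vc] := vA a Aa; exists c; rewrite repr_mx1 mulmx1.
have [g Ag gx] : exists2 g, g \in A & (g * x = x ^+ (1 + p ^ m) * g)%g.
  apply: fullA; rewrite prime_coprime //
    -(prednK m_gt0) expnS dvdn_addl ?dvdn_mulr //.
  by rewrite dvdn1 neq_ltn prime_gt1 ?orbT.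
have Gg := fintype.subsetP sAG _ Ag.
have [|||v [nzv vx /(_ g (cycle_id g))[eps vg]]] := @exists_eigenline zeta u
  <[g]>%G nzu ux.
- by rewrite cycle_subG.
- exact: cycle_abelian.
- move=> _ /cycleP[s ->]; exists ((1 + p ^ m) ^ s)%N; first exact: twist_expg.
  elim: s => [|s IHs]; first by rewrite expr1.
  by rewrite expnS exprM exprD expr1 (prim_expr_order zeta_prim) mulr1.
(* The exponent of this power of g is 1 modulo p^n; hence eps has p-power order. *)
have gpn : (g ^+ (p ^ (n - m)) = 1)%g.
  have pN1 : ~~ (p %| 1)%N by rewrite dvdn1 neq_ltn prime_gt1 ?orbT.
  have [u' def_q _] := expn_1mod_pX p_prime p_odd (n - m) m_gt0 pN1.
  rewrite muln1 subnKC // in def_q.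
  apply: (@twist_inj _ _ _ 1 _ _ (twist_expg _ gx));
    rewrite ?groupX ?mulg1 ?mul1g ?expg1 //.
  by rewrite def_q mulnC addnC modnMDl.
have epn : eps ^+ (p ^ (n - m)) = 1.
  apply: (scale_vec_inj nzv); rewrite -(repr_mx_eigenX _ Gg vg) gpn.
  by rewrite repr_mx1 mulmx1 scale1r.
have [|r eps_prim /dvdn_pfactor] := prim_order_exists _ epn;
  first by rewrite expn_gt0 p_gt0.
case=> // k _ def_r; rewrite {r}def_r in eps_prim.
have [k0 | k_gt0] := posnP k.
  exact: (rank_rfix_trivial m_gt0 zeta_prim Ag gx nzv vx vg eps_prim k0).
have [lemk | ltkm] := leqP m k.
  exact: (rank_rfix_large m_gt0 zeta_prim Ag gx nzv vx vg eps_prim lemk).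
apply: (rank_rfix_small m_gt0 zeta_prim Ag gx nzv vx vg eps_prim).
by rewrite k_gt0.
Qed.

End HolomorphLike.

End Representations.

(** * The holomorph of a cyclic group of order p^n *)

Section TwistedAutomorphisms.

Variables (gT : finGroupType) (K : {group gT}) (z : gT).
Hypothesis Kz : z \in K.
Local Notation act := (aut_groupAction K).

(** The action is the conjugation [u ^ v] = v^-1 u v, so it is the inverse of the image of b that
    moves past x with exponent j. *)
Lemma sdpair_twist (b : {perm gT}) (j : nat) : b \in Aut K -> b z = z ^+ j ->
  (sdpair2 act b)^-1 * sdpair1 act z = sdpair1 act z ^+ j * (sdpair2 act b)^-1.
Proof.
move=> Ab bz; rewrite -morphX // -bz /=.
have -> : sdpair1 act (b z) = sdpair1 act z ^ sdpair2 act b by apply: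
  sdpair_act.
by rewrite /conjg !mulgA mulgK.
Qed.

End TwistedAutomorphisms.

Lemma Zp_cyclic (m : nat) : cyclic (Zp m).
Proof.
rewrite /Zp; case: ifP => _; last exact: cyclic1.
by apply/cyclicP; exists Zp1; rewrite Zp_cycle.
Qed.

Lemma hol_cyclic_rank1_rfix (C : numClosedFieldType) (p n : nat)
    (gT : finGroupType) (K : {group gT}) (d : nat)
    (rho : mx_representation C (Hol K) d) :
    prime p -> odd p -> 0 < n -> cyclic K -> #|K| = (p ^ n)%N ->
    mx_irreducible rho ->
  exists2 H : {group sdprod_by (aut_groupAction K)},
    H \subset Hol K & \rank (rfix_mx rho H) = 1%N.
Proof.
move=> p_prime p_odd n_gt0 cycK cardK irr; have [z defK] := cyclicP cycK.
have Kz : z \in K by rewrite defK cycle_id.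
have pK : p.-group K by rewrite /pgroup cardK pnatX pnat_id.
have ntK : K != 1 :> {set gT}.
  by rewrite -cardG_gt1 cardK -(expn0 p) ltn_exp2l ?prime_gt1.
have [m [[mX _ [_ m_unit] _ _] [abA _ _ _] _]] := cyclic_pgroup_Aut_structure
  pK cycK ntK.
pose act := aut_groupAction K; pose x := sdpair1 act z.
have bz b : b \in Aut K -> b z = z ^+ m b by move=> Ab; rewrite -mX.
apply: (@exists_rank1_rfix p n p_prime p_odd _ _ (sdpair2 act @* Aut K)%G x);
  rewrite ?inE //.
- by rewrite -morphX // -cardK expg_cardG ?morph1.
- exact: finset.subsetT.
- exact: morphim_abelian.
- move=> y _; have : y \in sdpair1 act @* K * sdpair2 act @* Aut K by rewrite
    im_sdpair inE.
  case/mulsgP=> _ a /morphimP[k _ Kk ->] Aa ->.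
  move: Kk; rewrite {1}defK => /cycleP[i ->]; exists i, a => //.
  by rewrite morphX.
- move=> _ /morphimP[b _ Ab ->]; exists (m b^-1 : nat).
  have := sdpair_twist Kz (groupVr Ab) (bz _ (groupVr Ab)).
  by rewrite morphV // invgK.
(* Since |K| > 1, ['Z_#|K|] is the ring of integers modulo |K|, and each of its units is the
   exponent of an automorphism. *)
- move=> j coj; have q_gt1 : 1 < #|K| by rewrite cardG_gt1.
  have : (j%:R : 'Z_#|K|)%R \in [seq m b | b in Aut K].
    by rewrite m_unit unitZpE // cardK coprimeXl.
  case/fintype.imageP=> b Ab def_j; exists (sdpair2 act b)^-1;
    first by rewrite groupV mem_morphim.
  apply: sdpair_twist => //; rewrite bz // -def_j val_Zp_nat //.
  by rewrite expg_mod // expg_cardG.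
- move=> _ /morphimP[b _ Ab ->] comm; rewrite -(morph1 (sdpair2 act));
    congr (_ _).
  apply: (eq_Aut Ab (group1 _)) => y; rewrite perm1 {1}defK => /cycleP[i ->].
  have bz1 : b z = z.
    apply: (injmP (injm_sdpair1 act)); rewrite ?Aut_closed //=.
    have -> : sdpair1 act (b z) = sdpair1 act z ^ sdpair2 act b by apply:
      sdpair_act.
    by rewrite /conjg -comm mulKg.
  by rewrite -mX ?groupX // -expgM mulnC expgM -bz // bz1.
Qed.

End Holomorph.

Theorem lemma7p0p1 (R : realType) (p n : nat) (p_prime : prime p)
    (p_odd : odd p) (n_ge1 : 1 <= n)
    (d : nat) (rho : mx_representation (complex R) (HolC (p ^ n)%N) d)
    (rho_irr : mx_irreducible rho) :
  schur_index rho = 1%N.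
Proof.
have card_Zpn : #|Zp (p ^ n)| = (p ^ n)%N by rewrite card_Zp //
  expn_gt0 prime_gt0.
have [H sHG rankH] := hol_cyclic_rank1_rfix p_prime p_odd n_ge1 (Zp_cyclic _)
  card_Zpn rho_irr.
exact (schur_index_eq1 rho_irr sHG rankH).
Qed.
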